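(* Let $X=\{0,1,i\}\subseteq\mathbb{C}$, $i=\sqrt{-1}$, and consider the bounded sequence $$d=\left(\tfrac12,\ \tfrac{i}{2},\ \tfrac{1+i}{2},\ 0,1,i,0,1,i,0,1,i,\dots\right)$$ (after the first three terms, the block $0,1,i$ repeats indefinitely). Then $d$ belongs to $\mathrm{Lim}^1(X)$ and the renormalized sum $s_X(d)\in\Gamma_X$ vanishes, but there is no normal operator in $\mathcal{N}(X)$ whose diagonal relative to some orthonormal basis is $d$.
   Context: For a finite set $X=\{\lambda_1,\dots,\lambda_N\}\subseteq\mathbb{C}$: $\mathrm{Lim}^1(X)$ is the set of all bounded complex sequences $a=(a_n)_{n\ge1}$ with $\sum_{n=1}^\infty d(a_n,X)<\infty$, where $d(z,X)=\min_{\lambda\in X}|z-\lambda|$. $K_X$ is the additive subgroup of $\mathbb{C}$ of all $z=\nu_1\lambda_1+\cdots+\nu_N\lambda_N$ with $\nu_k\in\mathbb{Z}$ and $\nu_1+\cdots+\nu_N=0$, and $\Gamma_X=\mathbb{C}/K_X$. For $a\in\mathrm{Lim}^1(X)$ the renormalized sum $s_X(a)\in\Gamma_X$ is the coset $\sum_{n=1}^\infty(a_n-x_n)+K_X$, where $x=(x_n)$ is any sequence with $x_n\in X$ for all $n$ and $\sum_n|a_n-x_n|<\infty$; the coset does not depend on the choice of $x$. $H$ is a separable infinite-dimensional complex Hilbert space, and $\mathcal{N}(X)$ is the set of all normal operators $A\in\mathcal{B}(H)$ with $\sigma(A)=\sigma_e(A)=X$, where $\sigma_e$ denotes the essential spectrum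 (i.e. the spectrum of $A$ is $X$ and every point of $X$ is an eigenvalue of infinite multiplicity). The diagonal of $A$ relative to an orthonormal basis $e_1,e_2,\dots$ of $H$ is the sequence $(\langle Ae_n,e_n\rangle)_{n\ge1}$. *)

(* Defs.v *)
From HB Require Import structures.
From mathcomp Require Import all_boot all_order all_algebra.
From mathcomp Require Import generic_quotient ring_quotient sesquilinear finmap.
From mathcomp Require Import complex.
From mathcomp Require Import all_classical all_reals all_analysis.

Set Implicit Arguments.
Unset Strict Implicit.
Unset Printing Implicit Defensive.

Import Order.TTheory GRing.Theory Num.Theory numFieldNormedType.Exports.

Local Open Scope classical_set_scope.
Local Open Scope ring_scope.
Local Open Scope quotient_scope.

(* The bare type [R[i]] carries no topology: inference finds the one attached
   to [R[i]] as a field only when that structure is named. *)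
Notation CplxField R :=
  (complex_complex__canonical__Num_ClosedField R) (only parsing).
Notation Cplx R := (Num.ClosedField.sort (CplxField R)) (only parsing).

Section RenormalizedSum.
Variable R : realType.
Local Notation C := (Cplx R).
Implicit Types (X : {fset C}) (a x : nat -> C).

(* [Normc.normc] is the [R]-valued modulus; the generic norm [`|z|] of [z : C] is
   [C]-valued.  The value is [+oo] when [X] is empty. *)
Definition set_dist (z : C) X : \bar R :=
  \big[mine/+oo%E]_(l <- X) (Normc.normc (z - l))%:E.

Definition Lim1 X : set (nat -> C) :=
  [set a | bounded_fun a /\ (\sum_(0 <= n <oo) set_dist (a n) X < +oo)%E].

Definition K_ X : {pred C} := fun z => `[<
  exists nu : C -> int,
    \sum_(l <- X) nu l = 0 /\ z = \sum_(l <- X) l *~ nu l >].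

Lemma K_zmod_closed X : zmod_closed (K_ X).
Proof.
split=> [|z w /asboolP[nu [nu0 ->]] /asboolP[mu [mu0 ->]]]; apply/asboolP.
  by exists (fun=> 0); split; rewrite big1.
exists (fun l => nu l - mu l); split; first by rewrite sumrB nu0 mu0 subrr.
by rewrite -sumrB; apply: eq_bigr => l _; rewrite mulrzBr.
Qed.

HB.instance Definition _ X :=
  GRing.isZmodClosed.Build C (K_ X) (K_zmod_closed X).

Definition Gamma X : zmodType := Quotient.quot (K_ X).

Definition selection X a : set (nat -> C) :=
  [set x | (forall n, x n \in X) /\
           (\sum_(0 <= n <oo) (Normc.normc (a n - x n))%:E < +oo)%E].

(* An arbitrary selection is picked: when [Lim1 X a] holds one exists and the
   coset does not depend on which one is taken. *)
Definition renorm_sum X a : Gamma X :=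
  let x := xget (fun=> 0) (selection X a) in
  \pi_(Gamma X) (limn (series (fun n => a n - x n))).

End RenormalizedSum.

Section Operators.
Variables (R : realType) (H : completeNormedModType (CplxField R)).
Local Notation C := (Cplx R).
Implicit Types (A B : {linear H -> H}).

Definition separable := exists D : set H, countable D /\ dense D.

Definition infinite_dim := forall s : seq H,
  exists x : H, forall c : nat -> C, x <> \sum_(k < size s) c k *: s`_k.

(* [A] is bounded iff it is continuous. *)
Definition spectrum A : set C := [set l |
  ~ exists B, [/\ continuous B,
                  forall x, A (B x) - l *: B x = x &
                  forall x, B (A x - l *: x) = x]].

Definition compact_op (T : H -> H) :=
  compact (closure (T @` [set x | `|x| <= 1])).

(* The spectrum of the image of [A] in the Calkin algebra B(H)/K(H). *)
Definition ess_spectrum A : set C := [set l |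
  ~ exists B, [/\ continuous B,
                  compact_op (fun x => A (B x) - l *: B x - x) &
                  compact_op (fun x => B (A x - l *: x) - x)]].

Variable dot : {dot H for @Num.conj (CplxField R)}.

(* [H] is complete, so this makes [(H, dot)] a Hilbert space; [dot] is linear
   in its first argument. *)
Definition dot_norm := forall x, dot x x = `|x| ^+ 2.

Definition adjoint A B := forall x y, dot (A x) y = dot x (B y).

Definition normal_op A := continuous A /\
  exists B, [/\ continuous B, adjoint A B & forall x, A (B x) = B (A x)].

Definition normal_with_spectrum (X : {fset C}) : set {linear H -> H} :=
  [set A | [/\ normal_op A, spectrum A = [set` X] &
               ess_spectrum A = [set` X]]].

Definition orthonormal_basis (e : nat -> H) :=
  (forall m n, dot (e m) (e n) = (m == n)%:R) /\
  dense [set x | exists n (c : nat -> C), x = \sum_(k < n) c k *: e k].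

Definition diag_seq A (e : nat -> H) : nat -> C :=
  fun n => dot (A (e n)) (e n).

End Operators.

Section Example.
Variable R : realType.
Local Notation C := (Cplx R).

Definition X01i : {fset C} := [fset 0; 1; 'i]%fset.

(* Sequences are indexed from 0. *)
Definition d01i : nat -> C := fun n =>
  match n with
  | 0 => 1 / 2
  | 1 => 'i / 2
  | 2 => (1 + 'i) / 2
  | m.+3 => [:: 0; 1; 'i]`_(m %% 3)
  end.

End Example.

(* Main.v *)
Require Import Defs.
From mathcomp Require Import all_boot all_order all_algebra.
From mathcomp Require Import sesquilinear finmap complex.
From mathcomp Require Import all_classical all_reals all_analysis.
From mathcomp Require Import ring lra.
Import numFieldNormedType.Exports.
Local Open Scope ring_scope.

(** Each of the first three terms of [d] is the midpoint of a side of the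
    triangle [0, 1, i], and all the other terms are vertices.

    Membership in Lim^1 and vanishing of the renormalized sum: moving the first
    three terms to [0, i, 1] changes their sum by
    [1/2 + i/2 + (1+i)/2 - (0 + i + 1) = 0].  Any other selection [x] agrees
    with [d] from some index on, because the points of [X] are at distance at
    least one from each other; so the sum of [d - x] is a finite sum of
    differences of points of [X], an element of [K_X].

    Nonexistence of the operator: let [A] be normal with spectrum [X] and
    diagonal [d] along the orthonormal basis [e].  Let [c = (1+i)/2] be the
    circumcentre of the triangle and [r] the circumradius.  The norm of the
    normal operator [A - c] is at most [r] ([normal_spectrum_disc]).  If
    [<A e_n, e_n>] is a vertex, hence at distance exactly [r] from [c], then
    Pythagoras leaves no room for a component of [A e_n] orthogonal to [e_n], so
    [e_n] is an eigenvector ([extremal_eigenvector]), also for the adjoint.  The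
    span of [e_0, e_1, e_2] therefore reduces [A], and in this basis [A] acts on
    it by a normal matrix whose eigenvalues lie in [X] and whose diagonal is
    [1/2, i/2, (1+i)/2].  Its trace [1 + i] forces the eigenvalues to be [0],
    [1] and [i], once each.  The diagonal then prescribes the absolute values of
    the entries of a diagonalizing unitary matrix; the rows of the eigenvalues
    [1] and [i] are [1/sqrt 2, 0, 1/sqrt 2] and [0, 1/sqrt 2, 1/sqrt 2] in
    absolute value and cannot be orthogonal ([no_normal_matrix3]).

    The bound on a normal operator [T] by the radius of a disc around [0]
    containing its spectrum ([normal_rnorm_le]) is proved without the spectral
    theorem or complex analysis.  Suppose that the norm [M] of [T] exceeds the
    radius.  By compactness [T - mu] is bounded below uniformly for [mu] in a
    thin annulus with outer radius [M].  For a unit vector [x] with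
    [q = |T x|] close to [M], the norms of the iterates satisfy
    [|T^j x| >= q^j].  For [|z| = q] put [y = sum_(j < n) z^-j T^j x]; then
    [T y - z y = z (z^-n T^n x - x)] has norm at most [3 M], whereas a suitable
    [z] makes [|y|] at least [sqrt n] ([unimodular_combination]).  This
    contradicts the lower bound once [n] is large. *)

Set Implicit Arguments.
Unset Strict Implicit.
Unset Printing Implicit Defensive.

Import Order.TTheory GRing.Theory Num.Theory.
Local Open Scope classical_set_scope.

Local Notation normc := Normc.normc.

(** * Real-valued modulus and norm *)

Section Modulus.
Context {R : realType}.
Local Notation C := (Cplx R).
Implicit Types z w : C.

Lemma normc_normr z : `|z| = ((normc z)%:C)%C :> C.
Proof. by case: z => a b; rewrite normc_def. Qed.

Lemma normc_ge0 z : 0 <= normc z.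
Proof. by case: z => a b; exact: sqrtr_ge0. Qed.

Lemma normc_real (r : R) : normc (r%:C)%C = `|r|.
Proof. by rewrite /= expr0n addr0 sqrtr_sqr. Qed.

Lemma normcX z n : normc (z ^+ n) = normc z ^+ n.
Proof. by elim: n => [|n IH]; rewrite ?expr0 ?Normc.normc1 // !exprS Normc.normcM IH. Qed.

End Modulus.

Section HilbertNorm.
Context {R : realType} {H : completeNormedModType (CplxField R)}.
Local Notation C := (Cplx R).
Implicit Types (x y : H) (z : C).

(** The norm of a normed module over the complex numbers is complex-valued; its
    real part is used so that suprema and the total order are available. *)
Definition rnorm x : R := complex.Re `|x|.

Lemma rnormE x : `|x| = ((rnorm x)%:C)%C :> C.
Proof. by rewrite /rnorm RRe_real // normr_real. Qed.

Lemma rnorm_ge0 x : 0 <= rnorm x.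
Proof. by rewrite -lecR -rnormE normr_ge0. Qed.

Lemma rnorm0 : rnorm 0 = 0.
Proof. by rewrite /rnorm normr0. Qed.

Lemma rnorm_eq0 x : rnorm x = 0 -> x = 0.
Proof. by move=> x0; apply/eqP; rewrite -normr_eq0 rnormE x0. Qed.

Lemma rnorm_gt0 x : x != 0 -> 0 < rnorm x.
Proof.
move=> x0; rewrite lt_neqAle rnorm_ge0 andbT eq_sym.
by apply: contra_neq x0; exact: rnorm_eq0.
Qed.

Lemma rnormD x y : rnorm (x + y) <= rnorm x + rnorm y.
Proof. by rewrite -lecR rmorphD /= -!rnormE ler_normD. Qed.

Lemma rnormZ z x : rnorm (z *: x) = normc z * rnorm x.
Proof. by apply: complexI; rewrite rmorphM /= -!rnormE normrZ normc_normr. Qed.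

Lemma rnormN x : rnorm (- x) = rnorm x.
Proof. by rewrite /rnorm normrN. Qed.

Lemma rnormB x y : rnorm (x - y) <= rnorm x + rnorm y.
Proof. by rewrite (le_trans (rnormD _ _)) // rnormN. Qed.

Context {dot : {dot H for @Num.conj (CplxField R)}} (dotn : dot_norm dot).

Lemma dot_rnorm x : dot x x = ((rnorm x ^+ 2)%:C)%C.
Proof. by rewrite dotn rnormE rmorphXn. Qed.

Lemma dotC x y : dot x y = (dot y x)^*.
Proof. by rewrite hermC expr0 mul1r. Qed.

Lemma parallelogram x y :
  rnorm (x + y) ^+ 2 + rnorm (x - y) ^+ 2 = 2 * (rnorm x ^+ 2 + rnorm y ^+ 2).
Proof.
apply: complexI; rewrite rmorphM !rmorphD /= -!dot_rnorm dnormD dnormB.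
by ring.
Qed.

Lemma cauchy_schwarz x y : normc (dot x y) <= rnorm x * rnorm y.
Proof.
have [->|y0] := eqVneq y 0; first by rewrite linear0r Normc.normc0 rnorm0 mulr0.
have y2 : 0 < rnorm y ^+ 2 by rewrite exprn_gt0 // rnorm_gt0.
have key : rnorm (dot y y *: x - dot x y *: y) ^+ 2 =
  rnorm y ^+ 2 * ((rnorm x * rnorm y) ^+ 2 - normc (dot x y) ^+ 2).
  apply: complexI; rewrite -dot_rnorm dnormB /= !dnormZ.
  rewrite linearZl_LR linearZr_LR /= !rmorphM rmorphB !rmorphXn /=.
  rewrite rmorphM exprMn -!normc_normr -!rnormE !dotn.
 
  rewrite !normCK conjCK !(conj_Creal (rpredX 2 (normr_real y))) /= -!rnormE.
  by ring.
have : 0 <= (rnorm x * rnorm y) ^+ 2 - normc (dot x y) ^+ 2.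
  by rewrite -(pmulr_rge0 _ y2) -key sqr_ge0.
rewrite subr_ge0 ler_sqr ?nnegrE ?mulr_ge0 ?rnorm_ge0 //; exact: normc_ge0.
Qed.

(** Some unimodular [mu] makes the combination of the [v j] with coefficients
    [mu ^+ j] at least as long as if the [v j] were orthogonal: when the
    sum is folded in two halves, one sign in the parallelogram law keeps the sum
    of squared norms at least as large.  This stands for averaging over the roots
    of order [2 ^ m] of [c], a number that varies in the induction. *)
Lemma unimodular_combination m (v : nat -> H) c : normc c = 1 ->
  exists mu : C, normc mu = 1 /\ mu ^+ (2 ^ m) = c /\
    \sum_(j < 2 ^ m) rnorm (v j) ^+ 2 <=
      rnorm (\sum_(j < 2 ^ m) mu ^+ j *: v j) ^+ 2.
Proof.
elim: m v c => [|m IH] v c c1.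
  by exists c; rewrite !big_ord1 expr0 scale1r.
pose b : C := sqrtC c; pose w (s : C) j := v j + s *: v (2 ^ m + j)%N.
have b1 : normc b = 1.
  apply/eqP; rewrite -(@eqrXn2 _ 2) ?normc_ge0 ?ler01 // -normcX sqrtCK c1 expr1n //.
pose S := \sum_(j < 2 ^ m.+1) rnorm (v j) ^+ 2.
have SE : \sum_(j < 2 ^ m) rnorm (w b j) ^+ 2 +
    \sum_(j < 2 ^ m) rnorm (w (- b) j) ^+ 2 = 2 * S.
  rewrite /S expnS mul2n -addnn big_split_ord /= -!big_split mulr_sumr /=.
  apply: eq_bigr => j _; rewrite /w scaleNr parallelogram rnormZ b1 mul1r.
  by [].
have [s [s1 [s2 sS]]] : exists s : C, normc s = 1 /\ s ^+ 2 = c /\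
    S <= \sum_(j < 2 ^ m) rnorm (w s j) ^+ 2.
  have [Sb|Sb] := leP S (\sum_(j < 2 ^ m) rnorm (w b j) ^+ 2).
    by exists b; rewrite sqrtCK.
  exists (- b); rewrite normcN sqrrN sqrtCK; split=> //; split=> //.
  by move: SE Sb; lra.
have [mu [mu1 [muE muS]]] := IH (w s) s s1.
exists mu; split=> //; split; first by rewrite expnSr exprM muE.
apply: (le_trans sS); apply: (le_trans muS); rewrite le_eqVlt; apply/orP; left.
apply/eqP; congr (rnorm _ ^+ 2).
rewrite expnS mul2n -addnn big_split_ord /= -big_split /=.
apply: eq_bigr => j _; rewrite /w scalerDr scalerA exprD muE.
by rewrite mulrC.
Qed.

End HilbertNorm.

(** * Lower bounds for [T - mu] *)

Section ApproximateSpectrum.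
Context {R : realType} {H : completeNormedModType (CplxField R)}.
Local Notation C := (Cplx R).
Implicit Types (x y : H) (mu z : C) (T S : {linear H -> H}).

Lemma continuous_rnorm_le T : continuous T ->
  exists2 K, 0 < K & forall x, rnorm (T x) <= K * rnorm x.
Proof.
move=> /linear_bounded_continuous /linear_boundedP /pinfty_ex_gt0[k k0 kT].
have kE : (complex.Re k)%:C%C = k :> C by rewrite RRe_real // gtr0_real.
exists (complex.Re k) => [|x]; first by rewrite -ltcR kE.
by rewrite -lecR rmorphM /= -!rnormE kE.
Qed.

Lemma rnorm_iter_le T K n x : 0 <= K ->
  (forall x, rnorm (T x) <= K * rnorm x) ->
  rnorm (iter n T x) <= K ^+ n * rnorm x.
Proof.
move=> K0 TK; elim: n => [|n IH]; first by rewrite expr0 mul1r.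
by rewrite iterS exprS -mulrA (le_trans (TK _)) // ler_wpM2l.
Qed.

Definition bounded_below T mu :=
  exists2 g : R, 0 < g & forall x, g * rnorm x <= rnorm (T x - mu *: x).

Lemma normc_subC (a b a' b' : R) :
  normc ((a +i* b)%C - (a' +i* b')%C : C) <= `|a - a'| + `|b - b'|.
Proof.
rewrite -(ler_pXn2r (n := 2)) ?nnegrE ?addr_ge0 ?normc_ge0 //.
rewrite sqrrD !real_normK ?num_real // sqr_sqrtr ?addr_ge0 ?sqr_ge0 //.
rewrite lerD2r lerDl mulrn_wge0 // mulr_ge0 //.
Qed.

(** The lower bound varies continuously with [mu], so it can be chosen uniformly
    on a compact annulus. *)
Lemma uniform_bounded_below T r r' K : r < r' ->
  (forall mu, r < normc mu -> bounded_below T mu) ->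
  exists2 e : R, 0 < e & forall mu, r' <= normc mu <= K ->
    forall x, e * rnorm x <= rnorm (T x - mu *: x).
Proof.
move=> rr' Tb.
pose P (e : R) (p : R * R) := r' <= normc (p.1 +i* p.2)%C ->
  forall x, e * rnorm x <= rnorm (T x - (p.1 +i* p.2)%C *: x).
have cK : compact (`[- K, K] `*` `[- K, K] : set (R * R)).
  by apply: compact_setX; exact: segment_compact.
have shift (a b a' b' d : R) : `|a - a'| < d / 2 -> `|b - b'| < d / 2 ->
    normc ((a +i* b)%C - (a' +i* b')%C : C) < d.
  move=> ha hb; apply: le_lt_trans (normc_subC _ _ _ _) _.
  by rewrite [ltRHS](splitr d) ltrD.
have near_p : forall p : R * R, (`[- K, K] `*` `[- K, K]) p ->
    \forall p' \near p & e \near 0^'+, P e p'.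
  case=> a b _.
  have [d [d0 dP]] : exists d : R, 0 < d /\ forall a' b' e,
      `|a - a'| < d / 2 -> `|b - b'| < d / 2 -> 0 < e < d -> P e (a', b').
    have [ab|ab] := ltP r (normc (a +i* b)%C).
      have [g g0 gT] := Tb _ ab.
      exists (g / 2); split; first by rewrite divr_gt0.
      move=> a' b' e ha hb /andP[e0 eg] _ x /=.
      have := shift _ _ _ _ _ ha hb; set z := (a +i* b)%C; set z' := (a' +i* b')%C.
      move=> zz'; have := gT x; rewrite -/z => gx.
      have -> : T x - z' *: x = (T x - z *: x) + (z - z') *: x.
        by rewrite scalerBl addrA subrK.
      have := rnormB (T x - z *: x + (z - z') *: x) ((z - z') *: x).
      rewrite addrK rnormZ => h.
      have x0 := rnorm_ge0 x.
      have : normc (z - z') * rnorm x <= g / 2 * rnorm x.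
        by rewrite ler_wpM2r // ltW.
      have : e * rnorm x <= g / 2 * rnorm x by rewrite ler_wpM2r // ltW.
      by move: gx h; lra.
    exists (r' - r); split; first by rewrite subr_gt0.
    move=> a' b' e ha hb _ /= ar'.
    have := shift _ _ _ _ _ ha hb; have := le_normcD (a +i* b)%C
      ((a' +i* b')%C - (a +i* b)%C).
    rewrite addrC subrK -opprB normcN; lra.
  exists (ball (a, b) (d / 2), [set e | 0 < e] `&` [set e | e < d]).
    split; first by apply: nbhsx_ballx; rewrite divr_gt0.
    apply: filterI; first exact: nbhs_right_gt.
    exact: nbhs_right_lt.
  by case=> [[a' b'] e] /= [[/= ha hb] /andP he]; exact: dP ha hb he.
have /compact_near_coveringP/(_ R (0^'+) P _ near_p) unif := cK.
have [e [e0 eP]] : exists e : R, 0 < e /\ `[- K, K] `*` `[- K, K] `<=` P e.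
  by near (0 : R)^'+ => e; exists e; split=> //; near: e.
exists e => // -[a b] /andP[rz zK]; apply: (eP (a, b)) => //.
have aK : `|a| <= K.
  apply: le_trans zK; rewrite -sqrtr_sqr ler_wsqrtr // lerDl sqr_ge0 //.
have bK : `|b| <= K.
  apply: le_trans zK; rewrite -sqrtr_sqr ler_wsqrtr // lerDr sqr_ge0 //.
by split; rewrite /= in_itv /= -ler_norml.
Unshelve. all: by end_near. Qed.

Lemma sub_geometric_sum T z n x : z != 0 ->
  let y := \sum_(j < n) z^-1 ^+ j *: iter j T x in
  T y - z *: y = z *: (z^-1 ^+ n *: iter n T x - x).
Proof.
move=> z0 /=; elim: n => [|n IH].
  by rewrite big_ord0 linear0 scaler0 subr0 expr0 scale1r subrr scaler0.
rewrite big_ord_recr /= linearD /= scalerDr opprD addrACA IH linearZ /=.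
rewrite !scalerBr [z *: (_ *: _)]scalerA exprS !scalerA mulrA mulfV // mul1r.
by rewrite addrC addrA subrK.
Qed.

End ApproximateSpectrum.

(** * The norm of a normal operator *)

Lemma bernoulli (R : realType) (t : R) n : 0 <= t <= 1 ->
  1 - n%:R * t <= (1 - t) ^+ n.
Proof.
move=> /andP[t0 t1]; elim: n => [|n IH]; first by rewrite expr0 mul0r subr0.
rewrite exprSr; apply: (@le_trans _ _ ((1 - n%:R * t) * (1 - t))).
  have n0 : 0 <= n%:R :> R by [].
  by rewrite -natr1; nra.
by rewrite ler_wpM2r // subr_ge0.
Qed.

Lemma expr_near_max (R : realType) (M : R) n : 0 < M ->
  exists2 q0, q0 < M & forall q, q0 < q -> M ^+ n <= 2 * q ^+ n.
Proof.
move=> M0; pose t : R := (2 * n.+1%:R)^-1.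
have t0 : 0 < t by rewrite invr_gt0 mulr_gt0.
have t1 : t <= 1 by rewrite invf_le1 ?mulr_gt0 // -natrM ler1n.
exists (M * (1 - t)) => [|q qt]; first by nra.
have := @bernoulli R t n; rewrite ltW //= t1 => /(_ isT) bn.
have nt : n%:R * t <= 2^-1.
  by rewrite /t invfM mulrCA ger_pMr ?invr_gt0 // ler_pdivrMr // mul1r ler_nat.
have h3 : (M * (1 - t)) ^+ n <= q ^+ n.
  have Mt : 0 <= M * (1 - t) by rewrite mulr_ge0 ?subr_ge0 ?(ltW M0).
  by rewrite lerXn2r ?nnegrE ?(ltW qt) // (le_trans Mt) ?ltW.
rewrite -ler_pdivrMl // mulrC (le_trans _ h3) // exprMn.
by rewrite ler_wpM2l ?exprn_ge0 ?(ltW M0) // (le_trans _ bn) //; lra.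
Qed.

Section NormalOperators.
Context {R : realType} {H : completeNormedModType (CplxField R)}.
Context {dot : {dot H for @Num.conj (CplxField R)}} (dotn : dot_norm dot).
Local Notation C := (Cplx R).
Context {T S : {linear H -> H}} (adjTS : adjoint dot T S)
  (commTS : forall x, T (S x) = S (T x)).
Implicit Types (x y : H).

Lemma normal_rnorm_adjoint x : rnorm (S x) = rnorm (T x).
Proof.
apply/eqP; rewrite -(@eqrXn2 _ 2) ?rnorm_ge0 //; apply/eqP/complexI.
by rewrite -!(dot_rnorm dotn) [RHS]adjTS -commTS [RHS]dotC adjTS -dotC.
Qed.

Lemma normal_rnorm_sqr x : rnorm (T x) ^+ 2 <= rnorm x * rnorm (T (T x)).
Proof.
rewrite -[X in _ * X]normal_rnorm_adjoint.
rewrite (le_trans _ (cauchy_schwarz dotn _ _)) //.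
by rewrite -adjTS (dot_rnorm dotn) normc_real ger0_norm ?sqr_ge0.
Qed.

(** For a normal operator the norms of the iterates at a vector form a
    log-convex sequence, hence grow at least geometrically. *)
Lemma normal_rnorm_iter x n : rnorm x = 1 ->
  rnorm (T x) ^+ n <= rnorm (iter n T x).
Proof.
move=> x1.
have step j : rnorm (T x) * rnorm (iter j T x) <= rnorm (iter j.+1 T x).
  elim: j => [|j IH]; first by rewrite /= x1 mulr1.
  have [z|z] := eqVneq (iter j T x) 0.
    by rewrite !iterS z !linear0 rnorm0 mulr0.
  rewrite -(ler_pM2l (rnorm_gt0 z)) (le_trans _ (normal_rnorm_sqr _)) //.
  rewrite -iterS mulrCA mulrA expr2 ler_wpM2r ?rnorm_ge0 //.
elim: n => [|n IH]; first by rewrite expr0 /= x1.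
by rewrite exprS (le_trans _ (step n)) // ler_wpM2l ?rnorm_ge0.
Qed.

(** The norm of a normal operator is at most its spectral radius; the points
    [mu] where [T - mu] is bounded below stand for the resolvent set. *)
Theorem normal_rnorm_le (r : R) : continuous T -> 0 <= r ->
  (forall mu, r < normc mu -> bounded_below T mu) ->
  forall x, rnorm (T x) <= r * rnorm x.
Proof.
move=> Tcont r0 Tb x0; rewrite leNgt; apply/negP => x0r.
have [k k0 kT] := continuous_rnorm_le Tcont.
have x0n : x0 != 0.
  by apply: contraTneq x0r => ->; rewrite linear0 rnorm0 mulr0 ltxx.
pose E := [set rnorm (T x) | x in [set x | rnorm x = 1]].
have Ek : has_ubound E.
  by exists k => _ [x x1 <-]; rewrite (le_trans (kT x)) // x1 mulr1.
pose u : H := (((rnorm x0)^-1)%:C)%C *: x0.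
have scale t x : 0 < t -> rnorm ((t%:C)%C *: x) = t * rnorm x.
  by move=> t0; rewrite rnormZ normc_real gtr0_norm.
have px0 := rnorm_gt0 x0n; have ipx0 : 0 < (rnorm x0)^-1 by rewrite invr_gt0.
have Eu : E (rnorm (T u)).
  by exists u => //; rewrite /= scale // mulVf // gt_eqF.
pose M := sup E.
have rM : r < M.
  apply: lt_le_trans (ub_le_sup Ek Eu).
  by rewrite linearZ /= scale // ltr_pdivlMl // mulrC.
have M0 : 0 < M by apply: le_lt_trans rM.
have MT x : rnorm (T x) <= M * rnorm x.
  have [->|xn] := eqVneq x 0; first by rewrite linear0 rnorm0 mulr0.
  have px := rnorm_gt0 xn; have ipx : 0 < (rnorm x)^-1 by rewrite invr_gt0.
  have := @ub_le_sup _ E Ek (rnorm (T ((((rnorm x)^-1)%:C)%C *: x))).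
  rewrite linearZ /= scale // ler_pdivrMl // [M * _]mulrC; apply.
  exists ((((rnorm x)^-1)%:C)%C *: x); first by rewrite /= scale // mulVf // gt_eqF.
  by rewrite linearZ /= scale.
pose r' := (r + M) / 2.
have [e e0 eT] : exists2 e : R, 0 < e & forall mu, r' <= normc mu <= M ->
    forall x, e * rnorm x <= rnorm (T x - mu *: x).
  by apply: (uniform_bounded_below (r := r)) => //; rewrite /r'; lra.
(* With this [n], a vector [y] with [|y|^2 >= n] satisfies [e |y| > 3 M]. *)
have [n [m nE] nM] : exists2 n, (exists m, (2 ^ m)%N = n) &
    (3 * M) ^+ 2 < e ^+ 2 * n%:R.
  pose m := Num.bound ((3 * M / e) ^+ 2).
  exists (2 ^ m)%N; first by exists m.
  rewrite [ltRHS]mulrC -ltr_pdivrMr ?exprn_gt0 // -expr_div_n.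
  apply: (@lt_trans _ _ m%:R); last by rewrite ltr_nat ltn_expl.
  by rewrite /m archi_boundP ?sqr_ge0.
(* A unit vector so nearly maximal that the n-th powers are comparable. *)
have [x [x1 [xr' xM]]] : exists x, rnorm x = 1 /\ r' < rnorm (T x) /\
    M ^+ n <= 2 * rnorm (T x) ^+ n.
  have [q0 q0M q0P] := expr_near_max n M0.
  have : Num.max r' q0 < M by rewrite gt_max q0M andbT /r'; lra.
  move=> /(sup_gt (ex_intro _ _ Eu)) [_ [x x1 <-]].
  by rewrite gt_max => /andP[h1 h2]; exists x; split=> //; split=> //; exact: q0P.
pose q := rnorm (T x).
have qM : q <= M by have := MT x; rewrite x1 mulr1.
have q0 : 0 < q by rewrite (le_lt_trans _ xr') // /r'; lra.
have qn0 : 0 < q ^+ n by rewrite exprn_gt0.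
(* The combination of the [v j] given by [mu] is the geometric sum of [T] at
   [z = q / mu], a point of the annulus. *)
pose v j := ((q ^- j)%:C)%C *: iter j T x.
have v1 j : 1 <= rnorm (v j).
  rewrite scale ?invr_gt0 ?exprn_gt0 // ler_pdivlMl ?exprn_gt0 // mulr1.
  exact: normal_rnorm_iter.
have [mu [mu1 [_ muv]]] := unimodular_combination dotn m v (Normc.normc1 R).
rewrite nE in muv.
have mu0 : mu != 0.
  by apply/eqP => muz; move: mu1; rewrite muz Normc.normc0; lra.
pose z : C := (q%:C)%C * mu^-1.
have zq : normc z = q.
  by rewrite Normc.normcM Normc.normcV mu1 invr1 mulr1 normc_real gtr0_norm.
have qC0 : (q%:C)%C != 0 :> C.
  by apply/eqP => /complexI qq; move: q0; rewrite qq ltxx.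
have z0 : z != 0 by rewrite mulf_neq0 ?invr_eq0.
have zj j : z^-1 ^+ j = mu ^+ j * ((q ^- j)%:C)%C.
  by rewrite /z invfM invrK mulrC exprMn fmorphV rmorphXn exprVn.
have := @sub_geometric_sum _ _ T z n x z0; rewrite /=.
set y := \sum_(j < n) _ => yE.
have yv : y = \sum_(j < n) mu ^+ j *: v j.
  by apply: eq_bigr => j _; rewrite zj scalerA.
have yn : n%:R <= rnorm y ^+ 2.
  rewrite yv (le_trans _ muv) // -[X in X%:R](card_ord n) -sumr_const.
  by apply: ler_sum => j _; rewrite expr_ge1 ?rnorm_ge0.
have Ty : rnorm (T y - z *: y) <= 3 * M.
  rewrite yE rnormZ zq.
  have : rnorm (z^-1 ^+ n *: iter n T x - x) <= 3.
    apply: le_trans (rnormB _ _) _.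
    rewrite x1 rnormZ normcX Normc.normcV zq exprVn.
    have := rnorm_iter_le n x (ltW M0) MT; rewrite x1 mulr1 => h.
    have : (q ^+ n)^-1 * rnorm (iter n T x) <= 2.
      rewrite ler_pdivrMl // mulrC; exact: le_trans xM.
    by lra.
  move=> h; apply: (@le_trans _ _ (q * 3)); first by rewrite ler_wpM2l // ltW.
  by lra.
have := eT z; rewrite zq qM (ltW xr') => /(_ isT y) => h.
have h2 : (e * rnorm y) ^+ 2 <= (3 * M) ^+ 2.
  by rewrite lerXn2r ?nnegrE ?mulr_ge0 ?rnorm_ge0 ?(ltW e0) ?(ltW M0) // (le_trans h).
move: h2; rewrite exprMn leNgt => /negP; apply.
by apply: lt_le_trans nM _; rewrite ler_wpM2l // sqr_ge0.
Qed.

End NormalOperators.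

(** * Normal matrices of order three *)

Lemma sum_ord3 (V : zmodType) (F : 'I_3 -> V) :
  \sum_(j < 3) F j = F 0 + F 1 + F 2.
Proof.
rewrite !big_ord_recr big_ord0 /= add0r.
by congr (F _ + F _ + F _); exact: val_inj.
Qed.

(** The eigenvalues are [a j + i b j] and [W j k] is the squared modulus of the
    entry [j, k] of a diagonalizing unitary matrix.  Summing the equations shows
    that exactly one [a j] and exactly one [b j] are nonzero; [p] and [q] are
    their indices. *)
Lemma weights3 (R : realFieldType) (W : 'I_3 -> 'I_3 -> R) (a b : 'I_3 -> R) :
  (forall j, (a j, b j) \in [:: (0, 0); (1, 0); (0, 1)]) ->
  (forall j k, 0 <= W j k) -> (forall j, \sum_k W j k = 1) ->
  \sum_j a j * W j 0 = 2^-1 -> \sum_j a j * W j 1 = 0 ->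
  \sum_j a j * W j 2 = 2^-1 ->
  \sum_j b j * W j 0 = 0 -> \sum_j b j * W j 1 = 2^-1 ->
  \sum_j b j * W j 2 = 2^-1 ->
  exists p q : 'I_3, p != q /\
    ((W p 1 = 0 /\ W p 2 = 2^-1) /\ (W q 0 = 0 /\ W q 2 = 2^-1)).
Proof.
move=> ab W0 Wsum.
move: (Wsum 0) (Wsum 1) (Wsum 2) (W0 0 0) (W0 0 1) (W0 0 2) (W0 1 0) (W0 1 1)
  (W0 1 2) (W0 2 0) (W0 2 1) (W0 2 2) (ab 0) (ab 1) (ab 2).
rewrite !sum_ord3 !inE !xpair_eqE {Wsum W0 ab} => s0 s1 s2 ? ? ? ? ? ? ? ? ?.
move=> /or3P[] /andP[/eqP-> /eqP->] /or3P[] /andP[/eqP-> /eqP->]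
  /or3P[] /andP[/eqP-> /eqP->] r0 r1 r2 i0 i1 i2;
  solve [ exfalso; lra
   | exists 0, 1; do !split; lra | exists 0, 2; do !split; lra
   | exists 1, 0; do !split; lra | exists 1, 2; do !split; lra
   | exists 2, 0; do !split; lra | exists 2, 1; do !split; lra ].
Qed.

Section Matrix3.
Context {R : realType}.
Local Notation C := (Cplx R).

Lemma imE : ('i : C) = (0 +i* 1)%C.
Proof. by rewrite -complexiE. Qed.

Lemma half_complex (z : C) : z / 2 = z * (2^-1)%:C%C.
Proof. by rewrite fmorphV rmorph_nat. Qed.

(** The diagonal entries are averages of the eigenvalues with weights the squared
    moduli of a unitary matrix.  These weights are forced, and they make a single
    term of the inner product of two rows nonzero. *)
Lemma no_normal_matrix3 (M : 'M[C]_3) : M \is normalmx ->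
  (forall l, eigenvalue M l -> l \in [:: 0; 1; 'i]) ->
  M 0 0 = 1 / 2 -> M 1 1 = 'i / 2 -> M 2 2 = (1 + 'i) / 2 -> False.
Proof.
move=> /orthomx_spectralP ME Meig M0 M1 M2.
set P := spectralmx M in ME; set sp := spectral_diag M in ME.
have Pu : P \is unitarymx := spectral_unitarymx M.
have Punit := unitarymx_unit Pu.
have Prow i j : \sum_k P i k * (P j k)^* = (i == j)%:R.
  have /unitarymxP/matrixP/(_ i j) := Pu; rewrite !mxE => <-.
  by apply: eq_bigr => k _; rewrite !mxE.
have sp_eig j : sp 0 j \in [:: 0; 1; 'i].
  apply: Meig; apply/eigenvalueP; exists (row j P).
    rewrite -row_mul ME !mulmxA mulmxV // mul1mx.
    by rewrite row_mul row_diag_mx -scalemxAl -rowE.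
  apply: contra_eq_neq (Prow j j) => /rowP Pj0.
  rewrite eqxx big1 1?eq_sym ?oner_eq0 // => k _.
  by have := Pj0 k; rewrite !mxE => ->; rewrite mul0r.
pose W j k : R := normc (P j k) ^+ 2.
have WE j k : P j k * (P j k)^* = (W j k)%:C%C.
  by rewrite -normCK normc_normr rmorphXn.
have W0 j k : 0 <= W j k by rewrite sqr_ge0.
have Wsum j : W j 0 + W j 1 + W j 2 = 1.
  apply: complexI; rewrite !rmorphD /= -!WE.
  by have := Prow j j; rewrite eqxx sum_ord3.
have Mdiag k : M k k = \sum_j sp 0 j * (W j k)%:C%C.
  rewrite {1}ME invmx_unitary // mul_mx_diag mxE; apply: eq_bigr => j _.
  by rewrite !mxE -WE; ring.
have ReM k : \sum_j complex.Re (sp 0 j) * W j k = complex.Re (M k k).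
  rewrite Mdiag raddf_sum /=; apply: eq_bigr => j _.
  by case: (sp 0 j) => a b /=; rewrite mulr0 subr0.
have ImM k : \sum_j complex.Im (sp 0 j) * W j k = complex.Im (M k k).
  rewrite Mdiag raddf_sum /=; apply: eq_bigr => j _.
  by case: (sp 0 j) => a b /=; rewrite mulr0 add0r.
have simps := (@mul0r R, @mulr0 R, @mul1r R, @add0r R, @addr0 R, @subr0 R, @oppr0 R).
have cplxE (a b a' b' : R) : a = a' -> b = b' -> (a +i* b = a' +i* b')%C.
  by move=> -> ->.
have {}M0 : M 0 0 = (2^-1 +i* 0)%C.
  by rewrite M0 half_complex mul1r.
have {}M1 : M 1 1 = (0 +i* 2^-1)%C.
  by rewrite M1 half_complex imE; apply: cplxE; rewrite /= !simps.
have {}M2 : M 2 2 = (2^-1 +i* 2^-1)%C.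
  by rewrite M2 half_complex imE; apply: cplxE; rewrite /= !simps.
have [p [q [pq [[Wp1 Wp2] [Wq0 Wq2]]]]] : exists p q : 'I_3, p != q /\
    ((W p 1 = 0 /\ W p 2 = 2^-1) /\ (W q 0 = 0 /\ W q 2 = 2^-1)).
  apply: (@weights3 _ W (fun j => complex.Re (sp 0 j))
    (fun j => complex.Im (sp 0 j))) => //.
  - move=> j; have := sp_eig j; rewrite imE !inE => /or3P[] /eqP -> /=;
      rewrite !xpair_eqE !eqxx ?orbT //.
  - by move=> j; rewrite sum_ord3.
  - by rewrite ReM M0.
  - by rewrite ReM M1.
  - by rewrite ReM M2.
  - by rewrite ImM M0.
  - by rewrite ImM M1.
  - by rewrite ImM M2.
have := Prow p q; rewrite (negbTE pq) sum_ord3.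
have W00 j k : W j k = 0 -> P j k = 0.
  by move/eqP; rewrite sqrf_eq0 => /eqP /Normc.eq0_normc.
rewrite (W00 p 1) // (W00 q 0) // conjC0 mulr0 mul0r !add0r => /eqP.
rewrite mulf_eq0 conjC_eq0 => /orP[] /eqP P0.
  by move: Wp2; rewrite /W P0 Normc.normc0 expr0n /=; lra.
by move: Wq2; rewrite /W P0 Normc.normc0 expr0n /=; lra.
Qed.
End Matrix3.

(** * Operators on a Hilbert space *)

Section Hilbert.
Context {R : realType} {H : completeNormedModType (CplxField R)}.
Context {dot : {dot H for @Num.conj (CplxField R)}} (dotn : dot_norm dot).
Local Notation C := (Cplx R).
Implicit Types (x y : H) (z c l : C) (A B T S : {linear H -> H}).

Lemma rnorm_pythagoras x y : dot x y = 0 ->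
  rnorm (x + y) ^+ 2 = rnorm x ^+ 2 + rnorm y ^+ 2.
Proof.
move=> xy; apply: complexI; rewrite rmorphD /= -!(dot_rnorm dotn) dnormD xy.
by rewrite conjC0 !addr0.
Qed.

Lemma bounded_below_not_spectrum A l : ~ spectrum A l -> bounded_below A l.
Proof.
move=> /contrapT[B [Bcont _ BK]].
have [k k0 kB] := continuous_rnorm_le Bcont.
exists k^-1 => [|x]; first by rewrite invr_gt0.
by rewrite ler_pdivrMl // -{1}(BK x).
Qed.

Lemma eigenvector_spectrum A l x : x != 0 -> A x = l *: x -> spectrum A l.
Proof.
move=> x0 Ax [B [_ _ BK]]; move/eqP: x0; apply.
by rewrite -(BK x) Ax subrr linear0.
Qed.

Definition translate A c : {linear H -> H} := A \- c \*: idfun.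

Lemma adjoint_translate A B c : adjoint dot A B ->
  adjoint dot (translate A c) (translate B c^*).
Proof.
move=> AB x y; rewrite /= linearBl linearBr /= AB linearZl_LR linearZr_LR /=.
by rewrite conjCK.
Qed.

Lemma translate_comm A B c d : (forall x, A (B x) = B (A x)) ->
  forall x, translate A c (translate B d x) = translate B d (translate A c x).
Proof.
move=> AB x; rewrite /= !linearB !linearZ /= AB !scalerA [d * c]mulrC.
by rewrite addrACA.
Qed.

Lemma continuous_translate A c : continuous A -> continuous (translate A c).
Proof.
move=> Ac x; apply: cvgB; first exact: Ac.
exact: cvgZl_tmp.
Qed.

(** The translate [A - c] is normal with spectrum in the disc around [0], and
    outside its spectrum the bounded inverse supplies the lower bounds that
    [normal_rnorm_le] asks for. *)
Lemma normal_spectrum_disc A c (r : R) : normal_op dot A -> 0 <= r ->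
  (forall l, spectrum A l -> normc (l - c) <= r) ->
  forall x, rnorm (A x - c *: x) <= r * rnorm x.
Proof.
move=> [Ac [B [Bc AB comm]]] r0 sp.
apply: (@normal_rnorm_le _ _ _ dotn (translate A c) (translate B c^*)) => //.
- exact: adjoint_translate.
- exact: translate_comm.
- exact: continuous_translate.
move=> mu rmu; have /bounded_below_not_spectrum[g g0 gA] : ~ spectrum A (c + mu).
  by move=> /sp; rewrite addrC addKr leNgt rmu.
exists g => // x; rewrite (le_trans (gA x)) //= scalerDl opprD addrA //.
Qed.

(** Pythagoras: the component of [A e - c e] along [e] already has the largest
    possible length. *)
Lemma extremal_eigenvector A c (r : R) e :
  (forall x, rnorm (A x - c *: x) <= r * rnorm x) ->
  rnorm e = 1 -> r <= normc (dot (A e) e - c) -> A e = dot (A e) e *: e.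
Proof.
move=> Ar e1; set l := dot (A e) e => rl.
have orth : dot (A e - l *: e) ((l - c) *: e) = 0.
  rewrite linearZr_LR linearBl linearZl_LR /= (dot_rnorm dotn) e1.
  by rewrite expr1n mulr1 subrr mulr0.
have := rnorm_pythagoras orth.
rewrite rnormZ e1 mulr1 scalerBl addrA subrK => pyth.
have := Ar e; rewrite e1 mulr1 => Ae.
apply/eqP; rewrite -subr_eq0; apply/eqP/rnorm_eq0/eqP.
rewrite -sqrf_eq0 eq_le sqr_ge0 andbT.
have : rnorm (A e - c *: e) ^+ 2 <= normc (l - c) ^+ 2.
  by rewrite lerXn2r ?nnegrE ?rnorm_ge0 ?normc_ge0 // (le_trans Ae).
by rewrite pyth; lra.
Qed.

Lemma normal_eigenvector_adjoint A B l x : adjoint dot A B ->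
  (forall x, A (B x) = B (A x)) -> A x = l *: x -> B x = l^* *: x.
Proof.
move=> AB comm Ax; apply/eqP; rewrite -subr_eq0; apply/eqP/rnorm_eq0.
have := normal_rnorm_adjoint dotn (adjoint_translate l AB) (translate_comm l l^* comm) x.
by rewrite /= Ax subrr rnorm0.
Qed.

Lemma normal_dot A B x y : adjoint dot A B ->
  (forall x, A (B x) = B (A x)) -> dot (A x) (A y) = dot (B x) (B y).
Proof.
move=> AB comm.
by rewrite [LHS]AB -comm [LHS]dotC AB -dotC.
Qed.

(** * Orthonormal bases *)

Section Basis.
Context {e : nat -> H} (eb : orthonormal_basis dot e).

Lemma basis_orth_eq0 x : (forall n, dot x (e n) = 0) -> x = 0.
Proof.
move=> xe; apply: contrapT => /eqP x0.
have [_ dense_e] := eb.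
have x0C : (0 : C) < `|x| by rewrite normr_gt0.
have [] := dense_e (ball x `|x|).
- by exists x; exact: ballxx.
- exact: ball_open.
move=> y [xy [n [c yE]]].
have xy0 : dot x (- y) = 0.
  rewrite linearNr yE linear_sumr /= big1 ?oppr0 // => k _.
  by rewrite linearZr_LR /= xe mulr0.
move: xy; rewrite -ball_normE /= !rnormE ltcR.
rewrite -(@ltr_pXn2r _ 2) ?nnegrE ?rnorm_ge0 // rnorm_pythagoras // rnormN.
by rewrite ltNge lerDl sqr_ge0.
Qed.

Lemma basis_dot m n : dot (e m) (e n) = (m == n)%:R.
Proof. exact: eb.1. Qed.

Lemma basis_sum_dot N (c : nat -> C) n :
  dot (\sum_(k < N) c k *: e k) (e n) = if (n < N)%N then c n else 0.
Proof.
rewrite linear_sumlz /=; case: ifP => [nN|/negbT]; last rewrite -leqNgt => Nn.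
  rewrite (bigD1 (Ordinal nN)) //= linearZl_LR /= basis_dot eqxx mulr1.
  rewrite big1 ?addr0 // => k kn; rewrite linearZl_LR /= basis_dot.
  by rewrite (negbTE (kn : nat_of_ord k != n)) mulr0.
rewrite big1 // => k _; rewrite linearZl_LR /= basis_dot ltn_eqF ?mulr0 //.
exact: leq_trans (ltn_ord k) Nn.
Qed.

Lemma basis_expansion N x : (forall n, (N <= n)%N -> dot x (e n) = 0) ->
  x = \sum_(k < N) dot x (e k) *: e k.
Proof.
move=> xe; apply/eqP; rewrite -subr_eq0; apply/eqP/basis_orth_eq0 => n.
rewrite linearBl /= (basis_sum_dot N (fun k => dot x (e k))).
by case: ltnP => [|/xe ->]; rewrite ?subrr // subr0.
Qed.

Lemma dot_basis_expansion N x y : (forall n, (N <= n)%N -> dot x (e n) = 0) ->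
  dot x y = \sum_(k < N) dot x (e k) * (dot y (e k))^*.
Proof.
move=> xe; rewrite {1}(basis_expansion xe) linear_sumlz /=.
by apply: eq_bigr => k _; rewrite linearZl_LR /= [dot (e k) y]dotC.
Qed.

Lemma rnorm_basis n : rnorm (e n) = 1.
Proof.
apply/eqP; rewrite -(@eqrXn2 _ 2) ?rnorm_ge0 ?ler01 //; apply/eqP/complexI.
by rewrite -(dot_rnorm dotn) basis_dot eqxx expr1n.
Qed.

(** The transpose of the usual matrix of the compression: row [k] holds the
    coordinates of [A (e k)], so that row vectors act as coordinates. *)
Definition compression A N : 'M[C]_N := \matrix_(k, j) dot (A (e k)) (e j).

(** When the basis vectors from index [N] on are eigenvectors of the normal
    operator [A], hence also of its adjoint [B], the span of the first [N] ones
    is stable under both, and the compression inherits normality and spectrum. *)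
Section Tail.
Context {A B : {linear H -> H}} {N : nat}.
Context (AB : adjoint dot A B) (comm : forall x, A (B x) = B (A x)).
Context (tail : forall n, (N <= n)%N -> exists l, A (e n) = l *: e n).

Lemma tail_orth k n : (k < N)%N -> (N <= n)%N ->
  dot (A (e k)) (e n) = 0 /\ dot (B (e k)) (e n) = 0.
Proof.
move=> kN Nn; have [l Al] := tail Nn.
have kn : dot (e k) (e n) = 0 by rewrite basis_dot ltn_eqF // (leq_trans kN).
split.
  by rewrite AB (normal_eigenvector_adjoint AB comm Al) linearZr_LR /= kn mulr0.
by rewrite dotC -AB Al linearZl_LR /= [dot (e n) (e k)]dotC kn conjC0 mulr0 conjC0.
Qed.

Lemma compression_normal : compression A N \is normalmx.
Proof.
apply/normalmxP/matrixP => k l; rewrite !mxE.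
transitivity (dot (A (e k)) (A (e l))).
  rewrite (dot_basis_expansion (N := N)) => [|n Nn].
    by apply: eq_bigr => j _; rewrite !mxE.
  by have [] := tail_orth (ltn_ord k) Nn.
rewrite (normal_dot _ _ AB comm) (dot_basis_expansion (N := N)) => [|n Nn].
  by apply: eq_bigr => j _; rewrite !mxE !AB [in LHS]dotC [dot (B (e l)) _]dotC conjCK.
by have [] := tail_orth (ltn_ord k) Nn.
Qed.

Lemma compression_eigenvalue l : eigenvalue (compression A N) l -> spectrum A l.
Proof.
move=> /eigenvalueP[v vM v0].
have /rV0Pn[j vj] := v0.
pose c k := if insub k is Some i then v 0 i else 0.
have cE (k : 'I_N) : c k = v 0 k by rewrite /c valK.
pose x := \sum_(k < N) c k *: e k.
apply: (@eigenvector_spectrum _ _ x).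
  apply: contraNneq vj => x0; rewrite -cE.
  have := basis_sum_dot N c j; rewrite ltn_ord -/x x0 linear0l => <- //.
have AE (k : 'I_N) : A (e k) = \sum_(i < N) compression A N k i *: e i.
  rewrite {1}(basis_expansion (N := N) (x := A (e k))) => [|n Nn].
    by apply: eq_bigr => i _; rewrite mxE.
  by have [] := tail_orth (ltn_ord k) Nn.
rewrite /x linear_sum scaler_sumr /=.
transitivity (\sum_(i < N) (v *m compression A N) 0 i *: e i).
  under eq_bigr do rewrite linearZ /= AE scaler_sumr.
  rewrite exchange_big /=; apply: eq_bigr => i _; rewrite mxE scaler_suml.
  by apply: eq_bigr => k _; rewrite scalerA cE.
by apply: eq_bigr => i _; rewrite vM mxE scalerA cE.
Qed.

End Tail.
End Basis.
End Hilbert.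

(** * The renormalized sum *)

Section Sequence.
Context {R : realType}.
Local Notation C := (Cplx R).
Local Notation X := (X01i R).
Local Notation d := (d01i R).
Implicit Types (z l : C) (a x : nat -> C) (Y : {fset C}).

Lemma X01iP l : reflect [\/ l = 0, l = 1 | l = 'i] (l \in X).
Proof.
rewrite /X01i !inE -!orbA.
by apply: (iffP or3P) => -[/eqP h|/eqP h|/eqP h];
  [apply: Or31|apply: Or32|apply: Or33|apply: Or31|apply: Or32|apply: Or33].
Qed.

Lemma d01i_tail n : (3 <= n)%N -> d n \in X.
Proof.
case: n => [|[|[|m]]] // _ /=; have : (m %% 3 < 3)%N by rewrite ltn_mod.
by case: (m %% 3)%N => [|[|[|]]] //= _; apply/X01iP;
  [apply: Or31|apply: Or32|apply: Or33].
Qed.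

Lemma set_dist_ge0 z Y : (0 <= set_dist z Y)%E.
Proof.
rewrite /set_dist; elim/big_ind: _ => //= [u v u0 v0|l _].
  by rewrite le_min u0.
by rewrite lee_fin normc_ge0.
Qed.

Lemma set_dist_le z Y l : l \in Y -> (set_dist z Y <= (normc (z - l))%:E)%E.
Proof. by move=> lY; rewrite /set_dist (big_rem l) //= ge_min lexx. Qed.

Lemma set_dist_eq0 z Y : z \in Y -> set_dist z Y = 0%E.
Proof.
move=> zY; apply/eqP; rewrite eq_le set_dist_ge0 andbT.
by have := set_dist_le z zY; rewrite subrr Normc.normc0.
Qed.

Lemma nneseries_finite_support (f : nat -> \bar R) N :
  (forall n, 0 <= f n)%E -> (forall n, f n < +oo)%E ->
  (forall n, (N <= n)%N -> f n = 0%E) -> (\sum_(0 <= n <oo) f n < +oo)%E.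
Proof.
move=> f0 foo fN; rewrite (nneseries_split 0 N) // add0n eseries0; last first.
  by move=> n Nn _; exact: fN.
by rewrite adde0; apply: lte_sum_pinfty.
Qed.

Lemma Lim1_d01i : Lim1 X d.
Proof.
split.
  have d1 n : `|d n| <= 1.
    have i1 : `|'i : C| = 1 by rewrite normCi.
    have half z : `|z| <= 1 + 1 -> `|z / 2| <= 1 :> C.
      by move=> z2; rewrite normrM normfV normr_nat ler_pdivrMr // mul1r.
    case: (ltnP n 3) => [|/d01i_tail/X01iP[]->]; rewrite ?normr0 ?normr1 ?i1 //.
    case: n => [|[|[|]]] //= _; apply: half; rewrite ?normr1 ?i1 ?lerDl //.
    by rewrite (le_trans (ler_normD _ _)) // normr1 i1.
  by exists 1; split=> // M M1 n _; exact: le_trans (d1 n) (ltW M1).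
apply: (nneseries_finite_support (N := 3)) => n; first exact: set_dist_ge0.
  apply: le_lt_trans (set_dist_le _ (_ : 0 \in X)) _; last exact: ltry.
  by apply/X01iP; apply: Or31.
by move=> n3; rewrite set_dist_eq0 // d01i_tail.
Qed.

Lemma sub_K Y l m : l \in Y -> m \in Y -> l - m \in K_ Y.
Proof.
move=> lY mY; apply/asboolP; exists (fun k => (k == l)%:R - (k == m)%:R).
have pick (V : zmodType) (F : C -> V) k : k \in Y ->
    \sum_(j <- Y) F j *~ (j == k)%:R = F k.
  move=> kY; rewrite (big_rem k) //= eqxx mulr1z big_seq big1 ?addr0 // => j.
  by rewrite mem_rem_uniq ?fset_uniq // !inE => /andP[/negbTE -> _]; rewrite mulr0z.
split; last first.
  under eq_bigr do rewrite mulrzBr.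
  by rewrite sumrB !pick.
rewrite sumrB; apply/eqP; rewrite subr_eq0; apply/eqP.
have int1 k : k \in Y -> \sum_(j <- Y) (j == k)%:R = 1 :> int.
  move=> kY; rewrite -[RHS](pick int (fun=> 1) k kY).
  by apply: eq_bigr => j _; rewrite /= intz.
by rewrite !int1.
Qed.

Lemma X01i_discrete l m : l \in X -> m \in X -> normc (l - m) < 1 -> l = m.
Proof.
have big (a b : R) : 1 <= a ^+ 2 + b ^+ 2 -> ~ (normc (a +i* b)%C < 1 :> R).
  move=> ab; apply/negP; rewrite -leNgt /= -(sqrtr1 R) ler_wsqrtr //.
have e00 : (0 : C) = (0 +i* 0)%C by [].
have e11 : (1 : C) = (1 +i* 0)%C by [].
by move=> /X01iP[] -> /X01iP[] -> //; rewrite ?imE ?e00 ?e11 => /big []; lra.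
Qed.

(** The differences [a n - x n] tend to zero and are eventually differences of
    points of [X], which are at distance at least one from each other. *)
Lemma selection_eventually a x : selection X a x ->
  (exists N, forall n, (N <= n)%N -> a n \in X) ->
  exists N, forall n, (N <= n)%N -> x n = a n.
Proof.
move=> [xX sx] [N aX].
have /cvg_series_cvg_0 : cvgn (series (fun n => normc (a n - x n))).
  by apply: nnseries_is_cvg => // n; exact: normc_ge0.
move=> /cvgr0_norm_lt/(_ 1 ltr01)[M _ MP].
exists (maxn N M) => n; rewrite geq_max => /andP[Nn Mn].
apply/esym/X01i_discrete => //; first exact: aX.
by have := MP n Mn; rewrite ger0_norm ?normc_ge0.
Qed.

(** Each of the first three terms is the midpoint of a side, and both ends of
    that side are nearest points; using every vertex once makes the three errors
    cancel. *)
Definition nearest01i n : C :=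
  match n with 0 => 0 | 1 => 'i | 2 => 1 | _ => d n end.

Lemma nearest01i_in n : nearest01i n \in X.
Proof.
by case: n => [|[|[|n]]] /=; last exact: (@d01i_tail n.+3);
  apply/X01iP; [apply: Or31|apply: Or33|apply: Or32].
Qed.

Lemma renorm_sum_d01i : renorm_sum X d = 0.
Proof.
have sel : selection X d nearest01i.
  split=> [n|]; first exact: nearest01i_in.
  apply: (nneseries_finite_support (N := 3)) => n; rewrite ?lee_fin ?normc_ge0 ?ltry //.
  by case: n => [|[|[|n]]] //= _; rewrite subrr Normc.normc0.
rewrite /renorm_sum; set x := xget _ _.
have selx : selection X d x by apply: (xgetPex (fun=> 0)); exists nearest01i.
have [N xN] := selection_eventually selx (ex_intro _ 3%N d01i_tail).
pose M := (maxn N 3).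
have sumE : \sum_(0 <= n < M) (d n - x n) = \sum_(0 <= n < M) (nearest01i n - x n).
  apply/eqP; rewrite -subr_eq0 -sumrB; apply/eqP.
  have M3 : (3 <= M)%N by exact: leq_maxr.
  rewrite (big_cat_nat (n := 3)) //= [X in _ + X]big_nat [X in _ + X]big1 ?addr0.
    by rewrite !big_nat_recr //= big_nil /=; field.
  case=> [|[|[|k]]] // _.
  by rewrite opprB addrA subrK subrr.
have -> : limn (series (fun n => d n - x n)) = \sum_(0 <= n < M) (nearest01i n - x n).
  rewrite -sumE.
  apply: lim_near_cst => //; exists M => // n /= Mn.
  rewrite /series /= (big_cat_nat (n := M)) //= [X in _ + X]big_nat.
  rewrite [X in _ + X]big1 ?addr0 //.
  by move=> k /andP[Mk _]; rewrite xN ?subrr // (leq_trans _ Mk) // leq_maxl.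
have sK : \sum_(0 <= n < M) (nearest01i n - x n) \in K_ X.
  by apply: rpred_sum => n _; apply: sub_K; [exact: nearest01i_in|exact: selx.1].
have := Quotient.idealrBE (K_ X) (\sum_(0 <= n < M) (nearest01i n - x n)) 0.
rewrite subr0 sK => /esym /eqP ->.
exact: (raddf0 \pi_(Gamma X)%qT).
Qed.

End Sequence.

(** * The circumscribed circle *)

Section Circle.
Context {R : realType}.
Local Notation C := (Cplx R).

Definition circumcentre : C := (1 + 'i) / 2.

Lemma circumradius l : l \in X01i R -> normc (l - circumcentre) = normc circumcentre.
Proof.
have -> : circumcentre = (2^-1 +i* 2^-1)%C.
  rewrite /circumcentre half_complex imE; apply/eqP; rewrite eq_complex /=.
  by apply/andP; split; apply/eqP; lra.
have e00 : (0 : C) = (0 +i* 0)%C by [].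
have e11 : (1 : C) = (1 +i* 0)%C by [].
by move=> /X01iP[] ->; rewrite ?imE ?e00 ?e11 /=; congr (Num.sqrt _); lra.
Qed.

Lemma no_normal_diag01i (H : completeNormedModType (CplxField R))
    (dot : {dot H for @Num.conj (CplxField R)}) (A : {linear H -> H})
    (e : nat -> H) :
  dot_norm dot -> normal_op dot A -> spectrum A = [set` X01i R] ->
  orthonormal_basis dot e -> diag_seq dot A e <> d01i R.
Proof.
move=> dotn An spA eb dA.
have spX l : spectrum A l -> l \in X01i R by rewrite spA.
have Adisc x : rnorm (A x - circumcentre *: x) <= normc circumcentre * rnorm x.
  apply: (normal_spectrum_disc dotn An); first exact: normc_ge0.
  by move=> l /spX /circumradius ->.
have dE n : dot (A (e n)) (e n) = d01i R n by rewrite -dA.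
have tail n : (3 <= n)%N -> exists l, A (e n) = l *: e n.
  move=> n3; exists (dot (A (e n)) (e n)).
  apply: (extremal_eigenvector dotn Adisc); first exact: (rnorm_basis dotn eb).
  by rewrite dE circumradius // d01i_tail.
have [_ [B [_ AB comm]]] := An.
apply: (@no_normal_matrix3 _ (compression (dot := dot) (e := e) A 3)).
- exact: (compression_normal dotn eb AB comm tail).
- move=> l /(compression_eigenvalue dotn eb AB comm tail)/spX/X01iP.
  by rewrite !inE => -[] ->; rewrite eqxx ?orbT.
- by rewrite mxE dE.
- by rewrite mxE dE.
- by rewrite mxE dE.
Qed.

End Circle.

Theorem proposition7p1 (R : realType) :
  Lim1 (X01i R) (d01i R) /\
  renorm_sum (X01i R) (d01i R) = 0 /\
  forall (H : completeNormedModType (CplxField R))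
    (dot : {dot H for @Num.conj (CplxField R)}),
    dot_norm dot -> separable H -> infinite_dim H ->
    ~ exists (A : {linear H -> H}) (e : nat -> H),
        normal_with_spectrum dot (X01i R) A /\
        orthonormal_basis dot e /\
        diag_seq dot A e = d01i R.
Proof.
split; first exact: Lim1_d01i.
split; first exact: renorm_sum_d01i.
move=> H dot dotn _ _ [A [e [[An spA _] [eb dA]]]].
exact: (no_normal_diag01i dotn An spA eb dA).
Qed.
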